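(* Let $D=(V,A)$ be an oriented graph. If ${\rm tt}(D)<|A|$, then $D$ has a Sullivan vertex, i.e. a vertex $u$ with $|N^{++}(u)|\ge |N^-(u)|$.
   Context: An oriented graph is a loopless digraph in which $xy\in A$ implies $yx\notin A$. $N^-(u)=\{v: vu\in A\}$, $N^+(u)=\{v:uv\in A\}$, $N^{++}(u)=\{v\in V: uw,wv\in A \text{ for some } w\}\setminus N^+(u)$. A transitive triangle is an orientation of $K_3$ having a source (a vertex dominating the other two); ${\rm tt}(D)$ denotes the number of transitive triangles in $D$ (i.e. the number of 3-vertex sets inducing a transitive triangle). *)

(* Defs.v *)
From mathcomp Require Import all_boot.

Set Implicit Arguments.
Unset Strict Implicit.
Unset Printing Implicit Defensive.

Section Digraph.

(* A digraph on the finite vertex set V is given by its set A of arcs;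
   (x, y) \in A is the arc xy, directed from x to y. *)
Variables (V : finType) (A : {set V * V}).

Definition oriented : Prop :=
  (forall x : V, (x, x) \notin A) /\
  (forall x y : V, (x, y) \in A -> (y, x) \notin A).

Definition in_nbhd (u : V) : {set V} := [set v | (v, u) \in A].

Definition out_nbhd (u : V) : {set V} := [set v | (u, v) \in A].

Definition out2_nbhd (u : V) : {set V} :=
  [set v | [exists w, ((u, w) \in A) && ((w, v) \in A)]] :\: out_nbhd u.

(* The first two conjuncts say that A induces an orientation of K_3 on S when
   A is oriented (which excludes arcs in both directions). *)
Definition transitive_triangle (S : {set V}) : bool :=
  [&& #|S| == 3,
      [forall x in S, forall y in S,
         (x != y) ==> ((x, y) \in A) || ((y, x) \in A)]
    & [exists s in S, forall y in S, (y != s) ==> ((s, y) \in A)]].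

Definition tt_count : nat := #|[set S : {set V} | transitive_triangle S]|.

Definition sullivan_vertex (u : V) : Prop := #|in_nbhd u| <= #|out2_nbhd u|.

End Digraph.

(* Main.v *)
Require Import Defs.
From mathcomp Require Import all_boot.

(** If no vertex is a Sullivan vertex, then [|N++(u)| + 1 <= |N-(u)|] for all
    [u].  For an arc [uv], every out-neighbour of [v] lies in [N++(u)] or in
    [N+(u)], so [|N+(v)| + 1 <= |N+(u) :&: N+(v)| + |N-(u)|].  Summed over all
    arcs, the terms [|N+(v)|] and [|N-(u)|] both count directed walks with two
    arcs and cancel, while [|N+(u) :&: N+(v)|] counts transitive triangles;
    hence [|A| <= tt(D)]. *)

Section ArcSums.

Variables (V : finType) (A : {set V * V}).

(** Partition the arcs by head: those ending at [v] each contribute [F v], and [pair^~ v] matches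
    them with the in-neighbours of [v]. *)
Lemma sum_arcs_head (F : V -> nat) :
  \sum_(p in A) F p.2 = \sum_v #|in_nbhd A v| * F v.
Proof.
rewrite (partition_big snd predT) //=; apply: eq_bigr => v _.
rewrite (eq_bigr (fun=> F v)) => [|p /andP[_ /eqP->] //].
rewrite sum_nat_const; congr (_ * _).
rewrite -(card_imset (in_nbhd A v) (f := pair^~ v)) => [|x y [] //].
apply: eq_card => -[x y]; rewrite unfold_in /=; apply/andP/imsetP.
  by move=> [xyA /eqP ?]; subst y; exists x; rewrite ?inE.
by case=> z; rewrite inE => zvA [-> ->].
Qed.

Lemma sum_arcs_tail (F : V -> nat) :
  \sum_(p in A) F p.1 = \sum_u #|out_nbhd A u| * F u.
Proof.
rewrite (partition_big fst predT) //=; apply: eq_bigr => u _.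
rewrite (eq_bigr (fun=> F u)) => [|p /andP[_ /eqP->] //].
rewrite sum_nat_const; congr (_ * _).
rewrite -(card_imset (out_nbhd A u) (f := pair u)) => [|x y [] //].
apply: eq_card => -[x y]; rewrite unfold_in /=; apply/andP/imsetP.
  by move=> [xyA /eqP ?]; subst x; exists y; rewrite ?inE.
by case=> z; rewrite inE => uzA [-> ->].
Qed.

(** Grouping the walks with two arcs by their middle vertex [v] turns either side into the sum of
    [#|in_nbhd A v| * #|out_nbhd A v|]. *)
Lemma sum_arcs_degrees :
  \sum_(p in A) #|out_nbhd A p.2| = \sum_(p in A) #|in_nbhd A p.1|.
Proof.
rewrite (sum_arcs_head (fun v => #|out_nbhd A v|)).
rewrite (sum_arcs_tail (fun u => #|in_nbhd A u|)).
by apply: eq_bigr => v _; rewrite mulnC.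
Qed.

Lemma card_out_nbhd_arc (u v : V) : (u, v) \in A ->
  #|out_nbhd A v| <= #|out_nbhd A u :&: out_nbhd A v| + #|out2_nbhd A u|.
Proof.
move=> uvA; rewrite -(cardsID (out_nbhd A u) (out_nbhd A v)) setIC leq_add2l.
apply/subset_leq_card/subsetP => w; rewrite !inE => /andP[-> vwA] /=.
by apply/existsP; exists v; rewrite uvA.
Qed.

Hypothesis hA : oriented A.

(** Transitive triangles listed in the order source, middle vertex, sink. *)
Definition transitive_triples : {set V * V * V} :=
  [set t | [&& (t.1.1, t.1.2) \in A, (t.1.1, t.2) \in A & (t.1.2, t.2) \in A]].

Lemma sum_arcs_common_out :
  \sum_(p in A) #|out_nbhd A p.1 :&: out_nbhd A p.2| = #|transitive_triples|.
Proof.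
rewrite -sum1_card; under eq_bigr do rewrite -sum1_card.
rewrite pair_big_dep /=; apply: eq_bigl => -[[u v] w].
by rewrite !inE.
Qed.

Lemma arc_neq {x y : V} : (x, y) \in A -> x != y.
Proof. by move=> xyA; apply: contraTneq xyA => ->; apply: hA.1. Qed.

Lemma transitive_triangle_triple (u v w : V) :
  (u, v, w) \in transitive_triples -> transitive_triangle A [set u; v; w].
Proof.
rewrite inE => /and3P[/= uvA uwA vwA]; apply/and3P; split.
(* There are no loops, so the three arcs force three distinct vertices. *)
- by rewrite setUC cardsU1 cards2 !inE negb_or ![w == _]eq_sym !arc_neq.
- apply/forall_inP => x; rewrite !inE -orbA => xS.
  apply/forall_inP => y; rewrite !inE -orbA => yS; apply/implyP.
  by case/or3P: xS => /eqP->; case/or3P: yS => /eqP->;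
    rewrite ?eqxx ?uvA ?uwA ?vwA ?orbT.
apply/exists_inP; exists u; first by rewrite !inE eqxx.
apply/forall_inP => y; rewrite !inE -orbA.
by case/or3P=> /eqP->; rewrite ?eqxx ?uvA ?uwA ?implybT.
Qed.

(** The arcs of a transitive triangle determine which vertex is its source, which its middle vertex
    and which its sink. *)
Lemma transitive_triple_inj :
  {in transitive_triples &,
    injective (fun t : V * V * V => [set t.1.1; t.1.2; t.2])}.
Proof.
have [irr asym] := hA.
move=> [[u v] w] [[x y] z]; rewrite !inE /=.
move=> /and3P[uvA uwA vwA] /and3P[xyA xzA yzA] eqS.
have mem a : a \in [set x; y; z] -> [\/ a = u, a = v | a = w].
  by rewrite -eqS !inE -orbA => /or3P[]/eqP ?;
    [apply: Or31|apply: Or32|apply: Or33].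
have /mem Hx : x \in [set x; y; z] by rewrite !inE eqxx.
have /mem Hy : y \in [set x; y; z] by rewrite !inE eqxx orbT.
have /mem Hz : z \in [set x; y; z] by rewrite !inE eqxx orbT.
have no a b : (a, b) \in A -> (b, a) \in A -> False.
  by move=> /asym/negP.
(* Of the 27 assignments, all but the identity repeat a vertex or reverse an arc; [no] refutes both,
   a loop being the case [a = b]. *)
by case: Hx => ?; case: Hy => ?; case: Hz => ?; subst => //; exfalso; eauto.
Qed.

Lemma card_transitive_triples : #|transitive_triples| <= tt_count A.
Proof.
rewrite -(card_in_imset transitive_triple_inj).
apply/subset_leq_card/subsetP => _ /imsetP[[[u v] w] tT ->].
by rewrite inE; apply: transitive_triangle_triple.
Qed.

End ArcSums.

Theorem theorem3p1 (V : finType) (A : {set V * V}) (hA : oriented A)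
    (htt : tt_count A < #|A|) :
  exists u : V, sullivan_vertex A u.
Proof.
have [/existsP //|/existsPn noS] :=
  boolP [exists u, #|in_nbhd A u| <= #|out2_nbhd A u|].
have: \sum_(p in A) (#|out_nbhd A p.2| + 1) <=
    \sum_(p in A) (#|out_nbhd A p.1 :&: out_nbhd A p.2| + #|in_nbhd A p.1|).
  apply: leq_sum => -[u v] /card_out_nbhd_arc le_uv /=.
  (* Strictness at the tail [u] supplies the [+ 1] of this arc; over all arcs these add up to
     [#|A|]. *)
  have := noS u; rewrite -ltnNge => lt_u.
  by rewrite addn1; apply: leq_ltn_trans le_uv _; rewrite ltn_add2l.
rewrite !big_split /= sum_arcs_degrees sum1_card sum_arcs_common_out.
rewrite addnC leq_add2r => leA.
by have := leq_trans leA (card_transitive_triples _ _ hA); rewrite leqNgt htt.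
Qed.
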